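(* For $0<a<1$ let $\delta(\mathcal{C}^1_a(t))$, $0<t\le 1$, denote the density of the hyp-hor covering $\mathcal{C}^1_a(t)$ of the hyperbolic plane $\mathbb{H}^2$ (defined in the context). Then $$\lim_{a\to 0^+}\delta\left(\mathcal{C}_a^1\left(\tfrac12\right)\right)=\frac{\sqrt{12}}{\pi},$$ and $$\delta\left(\mathcal{C}_a^1\left(\tfrac12\right)\right)>\frac{\sqrt{12}}{\pi}\qquad\text{for every } 0<a<1.$$ That is, the value $\frac{\sqrt{12}}{\pi}$ (the universal lower bound of covering densities in $\mathbb{H}^2$) can be approximated arbitrarily accurately by the densities $\delta(\mathcal{C}_a^1(\frac12))$: for every $\varepsilon>0$ there is $a\in(0,1)$ with $\left|\delta(\mathcal{C}_a^1(\frac12))-\frac{\sqrt{12}}{\pi}\right|<\varepsilon$.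
   Context: Use the Beltrami-Cayley-Klein disc model of the hyperbolic plane $\mathbb{H}^2$ (curvature $-1$), with homogeneous coordinates $(1,x,y)$ and absolute $x^2+y^2=1$. For $0<a<1$ let $A_0=(1,0,1)$ (an ideal point), $A_1=(1,0,0)$, $A_2=(1,\frac1a,0)$ (an outer point), and let $\pi$ be the polar line $x=a$ of $A_2$. Put $P_0=\pi\cap A_0A_2=(1,a,1-a^2)$ and $P_1=\pi\cap A_1A_2=(1,a,0)$. The Lambert quadrilateral $\mathcal{F}_a=A_0A_1P_1P_0$ has right angles at $A_1,P_1,P_0$ and angle $0$ at $A_0$; its area is $\frac{\pi}{2}$. Its images under the group generated by reflections in its sides tile $\mathbb{H}^2$. Covering $\mathcal{C}^1_a(t)$, $0<t\le 1$: let $M=(1,ta,1-ta^2)$, a point of the side $A_0P_0$. Take the horocycle centered at $A_0$ through $M$ and the hypercycle with base line $A_1P_1$ through $M$ (the curve at constant distance $h=d(M,A_1P_1)$ from that line). The horocycle piece $\mathfrak{H}_a(t)$ is the part of the horodisc lying between the lines $A_0A_1$ and $A_0P_0$; its area equals the length of the horocycle arc between these two lines. The hypercycle piece $\mathcal{H}_a(t)$ is the region between the segment $A_1P_1$ and the hypercycle (on the side of $A_1P_1$ containing $\mathcal{F}_a$), bounded laterally by the perpendiculars to $A_1P_1$ at $A_1$ and $P_1$; its area is $d(A_1,P_1)\sinh h$. The two pieces together cover $\mathcal{F}_a$, and their images under the reflection group form the hyp-hor covering $\mathcal{C}^1_a(t)$ of $\mathbb{H}^2$. Its density is $$\delta(\mathcal{C}^1_a(t))=\frac{Vol(\mathcal{H}_a(t))+Vol(\mathfrak{H}_a(t))}{Vol(\mathcal{F}_a)},$$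 where $Vol$ is hyperbolic area; explicitly $$\delta(\mathcal{C}_a^1(t))=\frac{2}{\pi}\left[\operatorname{arccosh}\left(\tfrac{1}{\sqrt{1-a^2}}\right)\frac{1-ta^2}{a\sqrt{2t-t^2-a^2t^2}}+2\sinh\left(\tfrac{1}{2}\operatorname{arccosh}\left(\tfrac{2ta^2+t-4}{2t-4+2ta^2}\right)\right)\right].$$ *)

(* Defs.v *)
From HB Require Import structures.
From mathcomp Require Import all_boot all_order all_algebra.
From mathcomp Require Import all_classical all_reals all_analysis.
Set Implicit Arguments.
Unset Strict Implicit.
Unset Printing Implicit Defensive.
Import Order.TTheory GRing.Theory Num.Theory.
Import numFieldNormedType.Exports.
Local Open Scope classical_set_scope.
Local Open Scope ring_scope.

(* Beltrami-Cayley-Klein model: p : R * R stands for the point with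
   homogeneous coordinates (1, p.1, p.2). *)

(* The bilinear form of signature (2,1) defining the absolute, evaluated on
   (1, p.1, p.2) and (1, q.1, q.2). *)
Definition form (R : realType) (p q : R * R) : R :=
  - 1 + p.1 * q.1 + p.2 * q.2.

Definition disc (R : realType) : set (R * R) := [set p | form p p < 0].

Definition arccosh (R : realType) (x : R) : R :=
  ln (x + Num.sqrt (x ^+ 2 - 1)).

(* Hyperbolic distance for curvature -1, for p and q in the disc. *)
Definition hdist (R : realType) (p q : R * R) : R :=
  arccosh (- form p q / Num.sqrt (form p p * form q q)).

(* Determinant of the homogeneous coordinates of p, q, r: it vanishes when
   r lies on the line pq and is positive when r is to the left of it. *)
Definition orient (R : realType) (p q r : R * R) : R :=
  (q.1 - p.1) * (r.2 - p.2) - (q.2 - p.2) * (r.1 - p.1).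

Definition hline (R : realType) (p q : R * R) : set (R * R) :=
  [set r | disc r /\ orient p q r = 0].

Definition left_side (R : realType) (p q : R * R) : set (R * R) :=
  [set r | disc r /\ 0 <= orient p q r].

Definition hdist_line (R : realType) (m : R * R) (L : set (R * R)) : R :=
  inf [set hdist m r | r in L].

(* Hyperbolic area: the Riemannian area element of the Klein model of
   curvature -1 is (1 - x^2 - y^2)^(-3/2) dx dy, and - form p p is
   1 - x^2 - y^2 at p = (x, y). *)
Definition Vol (R : realType) (S : set (R * R)) : \bar R :=
  (\int[(@lebesgue_measure R \x @lebesgue_measure R)%E]_(p in S)
     ((Num.sqrt (- form p p) ^+ 3)^-1)%:E)%E.

(* Horodisc centered at the ideal point c with m on its boundary: horocycles
   centered at c are the level curves of the Busemann function of c, which is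
   ln ((form c p)^2 / - form p p) / 2 up to an additive constant, and the
   function decreases to -oo towards c. *)
Definition horodisc (R : realType) (c m : R * R) : set (R * R) :=
  [set p | disc p /\
    form c p ^+ 2 / - form p p <= form c m ^+ 2 / - form m m].

Definition A0 (R : realType) : R * R := (0, 1).
Definition A1 (R : realType) : R * R := (0, 0).
Definition P0 (R : realType) (a : R) : R * R := (a, 1 - a ^+ 2).
Definition P1 (R : realType) (a : R) : R * R := (a, 0).
Definition M (R : realType) (a t : R) : R * R := (t * a, 1 - t * a ^+ 2).

(* A0, A1, P1, P0 is the counterclockwise order of the vertices; Klein lines
   are straight, so the quadrilateral is cut out by its four side lines.  The
   ideal vertex A0 does not belong to the disc. *)
Definition Lambert_quad (R : realType) (a : R) : set (R * R) :=
  left_side (A0 R) (A1 R) `&` left_side (A1 R) (P1 a) `&`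
  left_side (P1 a) (P0 a) `&` left_side (P0 a) (A0 R).

Definition horocycle_piece (R : realType) (a t : R) : set (R * R) :=
  horodisc (A0 R) (M a t) `&`
  left_side (A0 R) (A1 R) `&` left_side (P0 a) (A0 R).

(* The perpendiculars to A1P1 at A1 and at P1 are the side lines A0A1 and
   P1P0 of the quadrilateral. *)
Definition hypercycle_piece (R : realType) (a t : R) : set (R * R) :=
  let L := hline (A1 R) (P1 a) in
  [set p | disc p /\ hdist_line p L <= hdist_line (M a t) L] `&`
  left_side (A1 R) (P1 a) `&`
  left_side (A0 R) (A1 R) `&` left_side (P1 a) (P0 a).

(* All three areas are finite for 0 < a < 1 and 0 < t <= 1. *)
Definition density (R : realType) (a t : R) : R :=
  (fine (Vol (hypercycle_piece a t)) + fine (Vol (horocycle_piece a t)))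
  / fine (Vol (Lambert_quad a)).

(* Main.v *)
Require Import Defs.
From HB Require Import structures.
From mathcomp Require Import all_boot all_order all_algebra.
From mathcomp Require Import all_classical all_reals all_analysis.
From mathcomp Require Import measurable_realfun ring lra.
Import Order.TTheory GRing.Theory Num.Theory.
Import numFieldNormedType.Exports.
Local Open Scope classical_set_scope.
Local Open Scope ring_scope.

(** The three areas are computed in closed form, and the statement is then a
calculus fact about one function of a.

Area.  The lines through the ideal point A0 = (0, 1), other than the tangent
y = 1, are x = (1 - y) k, so a point of the disc is ((1 - y) k, y) with (k, 0)
on its line through A0.  With
Y ^ 2 = 2 / (1 - y) - (1 + k ^ 2), the pair (k, Y) is the Poincare half-plane
coordinate with A0 at infinity, and the area element becomes dk dY / Y ^ 2.
Hence the region Y ^ 2 >= w k over 0 <= k <= B has area the integral of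
1 / sqrt (w k) over [0, B] (Vol_above_graph).  This needs only a linear change
of variable on horizontal slices, Tonelli's theorem (Vol_pencil) and one
antiderivative (integral_geodesic_ray).
The horocycle piece has a constant w and B = 1 / a.  The Lambert quadrilateral
is bounded below by two geodesic half-circles, centred at k = 0 and k = 1 / a
and meeting over k = a, so that its area is asin a + asin (sqrt (1 - a ^ 2)),
that is pi / 2.
For the hypercycle piece, the distance to the x-axis is attained at the foot
(x, 0) of the perpendicular (hdist_line_axis).  The piece is therefore
y ^ 2 <= C ^ 2 (1 - x ^ 2 - y ^ 2) with C = sinh h, and integrating in y leaves
C times the integral of 1 / (1 - x ^ 2) over [0, a], which is the length
d(A1, P1) = (ln (1 + a) - ln (1 - a)) / 2.

Calculus.  Put z = a ^ 2 and r = d(A1, P1) / a.  The density at t = 1/2 is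
((2 - z) r + 1) / sqrt (3 - z) * (2 / pi) (density_half), and sqrt 12 / pi is
its value at z = 0, r = 1.  Comparing integrands,
1 + z / 3 + z ^ 2 / 5 <= r <= 1 / (1 - z).  The lower bound on r gives
(2 - z) r + 1 > 3 - z / 2 >= sqrt (9 - 3 z), which is the strict inequality; the
upper bound gives a majorant of the density that is continuous at a = 0, and the
limit follows by squeezing. *)

(** * Integration on the line *)

Section line_integration.
Context {R : realType}.
Local Notation mu := (@lebesgue_measure R).

(** On nonnegative reals the inverse is the real power -1, including the value
0 at 0, and real powers are measurable. *)
Lemma measurable_inv_ge0 d (T : measurableType d) (f : T -> R) :
  (forall x, 0 <= f x) -> measurable_fun [set: T] f ->
  measurable_fun [set: T] (fun x => (f x)^-1).
Proof.
move=> f0 mf; rewrite (_ : (fun x => _) = (fun x => f x `^ (-1))).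
  apply: (@measurableT_comp _ _ _ _ _ _ (fun x : R => x `^ (-1))); last exact: mf.
  exact: measurable_powR.
by apply/funext => x; rewrite powR_inv1.
Qed.

Lemma measurable_sqrt d (T : measurableType d) (f : T -> R) :
  measurable_fun [set: T] f ->
  measurable_fun [set: T] (fun x => Num.sqrt (f x)).
Proof.
move=> mf; apply: (@measurableT_comp _ _ _ _ _ _ (@Num.sqrt R)); last exact: mf.
by apply: continuous_measurable_fun; exact: sqrt_continuous.
Qed.

(** The image of Lebesgue measure under x |-> c x, multiplied by c, gives each
interval its length, so it is Lebesgue measure. *)
Lemma ge0_integral_scale (c : R) (f : R -> \bar R) : 0 < c ->
  measurable_fun setT f -> (forall x, 0 <= f x)%E ->
  (c%:E * \int[mu]_x f (c * x)%R = \int[mu]_x f x)%E.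
Proof.
move=> c0 mf f0.
pose g (x : measurableTypeR R) : measurableTypeR R := c * x.
have mg : measurable_fun [set: measurableTypeR R] g by exact: measurable_funM.
pose scaled : {measure set (measurableTypeR R) -> \bar R} :=
  mscale (NngNum (ltW c0)) (pushforward mu g).
transitivity (\int[scaled mg]_x f x)%E.
  by rewrite ge0_integral_mscale//= ge0_integral_pushforward.
apply: eq_measure_integral => A mA _; apply/esym.
apply: (@lebesgue_measure_unique R (scaled mg)) => //= X.
move=> [[a b]] _ <-.
rewrite [RHS]/= /mscale/= /pushforward.
rewrite (_ : _ @^-1` _ = `]a / c, b / c]%classic); last first.
  by apply/seteqP; split => x /=;
    rewrite !in_itv/= ltr_pdivrMr// ler_pdivlMr// mulrC.
rewrite !lebesgue_measure_itv/= !lte_fin ltr_pM2r ?invr_gt0//.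
case: ifPn => _; last by rewrite mule0.
by rewrite -!EFinB -EFinM -mulrBl mulrC divfK// gt_eqF.
Qed.

(** A form of the fundamental theorem whose hypotheses are pointwise; the case
a = b is allowed. *)
Lemma is_derive_FTC2 (f F : R -> R) (a b : R) : a <= b ->
  (forall x, x \in `[a, b] -> is_derive x 1 F (f x)) ->
  (forall x, x \in `[a, b] -> {for x, continuous f}) ->
  (\int[mu]_(x in `[a, b]) (f x)%:E = (F b - F a)%:E)%E.
Proof.
rewrite le_eqVlt => /predU1P[<- _ _|ab dF cf].
  by rewrite set_itv1 integral_set1 subrr.
have cF x : x \in `[a, b] -> {for x, continuous F}.
  move=> xab; apply: differentiable_continuous; apply/derivable1_diffP.
  by have [] := dF x xab.
have acc : a \in `[a, b] by rewrite in_itv/= lexx ltW.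
have bcc : b \in `[a, b] by rewrite in_itv/= lexx ltW.
rewrite (@continuous_FTC2 _ f F)//.
- apply: continuous_in_subspaceT => x; rewrite inE/=; exact: cf.
- split.
  + by move=> x xab; have [] := dF x (subset_itv_oo_cc xab).
  + exact/cvg_at_right_filter/cF.
  + exact/cvg_at_left_filter/cF.
- move=> x xab; rewrite derive1E.
  by have /@derive_val := dF x (subset_itv_oo_cc xab).
Qed.

(** The improper version: f may blow up at b.  Exhaust [a, b[ by the intervals
[a, u n] and pass to the limit by monotone convergence. *)
Lemma ge0_is_derive_FTC2_bndo (f F : R -> R) (a b l : R) : a < b ->
  (forall x, x \in `[a, b[ -> 0 <= f x) ->
  (forall x, x \in `[a, b[ -> is_derive x 1 F (f x)) ->
  (forall x, x \in `[a, b[ -> {for x, continuous f}) ->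
  F x @[x --> b^'-] --> l ->
  (\int[mu]_(x in `[a, b[) (f x)%:E = (l - F a)%:E)%E.
Proof.
move=> ab f0 dF cf Fl.
pose u (n : nat) : R := b - (b - a) / n.+1%:R.
have d0 : 0 < b - a by rewrite subr_gt0.
have ub n : u n < b.
  by rewrite /u gtrBl divr_gt0.
have au n : a <= u n.
  by rewrite /u lerBrDr addrC -lerBrDr ler_pdivrMr// ler_peMr ?ler1n// ltW.
have sub n x : x \in `[a, u n] -> x \in `[a, b[.
  by rewrite !in_itv/= => /andP[-> /le_lt_trans]; apply.
have u_nd : {homo u : m n / (m <= n)%N >-> m <= n}.
  move=> m n mn; rewrite /u lerD2l lerN2 ler_pM2l//.
  by rewrite lef_pV2 ?posrE// ler_nat.
have uE : (\bigcup_n `[a, u n] = `[a, b[)%classic.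
  apply/seteqP; split=> [x [n _] /sub//|x /=]; rewrite in_itv/= => /andP[ax xb].
  have bx0 : 0 < b - x by rewrite subr_gt0.
  exists (Num.truncn ((b - a) / (b - x))) => //=.
  rewrite in_itv/= ax/= /u lerBrDr addrC -lerBrDr ler_pdivrMr//.
  rewrite mulrC -ler_pdivrMr//; apply/ltW.
  exact: truncnS_gt.
have cu : u n @[n --> \oo] --> b.
  rewrite -[X in _ --> X]subr0; apply: cvgB; first exact: cvg_cst.
  rewrite -(mulr0 (b - a)); apply: cvgM; first exact: cvg_cst.
  exact: cvg_harmonic.
have := @ge0_nondecreasing_set_cvg_integral _ (measurableTypeR R) R (fun n => `[a, u n]%classic)
  (fun x => (f x)%:E) mu.
rewrite uE => H.
have : ((F (u n) - F a)%:E)%E @[n --> \oo] --> (l - F a)%:E.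
  apply: cvg_EFin; first exact: nearW.
  apply: cvgB; last exact: cvg_cst.
  move/cvg_at_leftP : Fl; apply; split => //.
move=> /(cvg_lim (@ereal_hausdorff R)) <-; apply/esym/cvg_lim => //.
rewrite (_ : (fun n : nat => _) =
    (fun n => \int[mu]_(x in `[a, u n]) (f x)%:E)%E); last first.
  apply/funext => n; apply/esym.
  exact: (@is_derive_FTC2 f F a (u n) (au n)
    (fun x xn => dF x (sub n x xn)) (fun x xn => cf x (sub n x xn))).
apply: H => //.
- move=> m n mn; apply/subsetPset => x/=; rewrite !in_itv/= => /andP[-> xm]/=.
  by rewrite (le_trans xm)// u_nd.
- move=> n; apply/measurable_EFinP.
  apply: subspace_continuous_measurable_fun => //.
  by apply: continuous_in_subspaceT => x; rewrite inE/= => /sub/cf.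
- by move=> n x /sub; rewrite lee_fin => /f0.
Qed.

Lemma integral_itv_split (f : R -> R) (a b c : R) : a <= b -> b <= c ->
  (forall x, 0 <= f x) -> measurable_fun [set: R] f ->
  (\int[mu]_(x in `[a, c]) (f x)%:E =
   \int[mu]_(x in `[a, b]) (f x)%:E + \int[mu]_(x in `[b, c]) (f x)%:E)%E.
Proof.
move=> ab bc f0 mf.
have mfE (D : set (measurableTypeR R)) : measurable_fun D (fun x => (f x)%:E).
  exact/measurable_EFinP/measurable_funTS.
rewrite -[in X in (_ = _ + X)%E]integral_itv_obnd_cbnd//.
rewrite -ge0_integral_setU//=.
- by rewrite -itv_bndbnd_setU// bnd_simp.
- by move=> x _; rewrite lee_fin.
- apply/disj_setPS => x/=; rewrite !in_itv/= => -[/andP[_ xb] /andP[bx _]].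
  by move: bx; rewrite ltNge xb.
exact: mfE.
Qed.

Lemma is_derive_sqrt_comp (g : R -> R) (x dg : R) : 0 < g x ->
  is_derive x 1 g dg ->
  is_derive x 1 (fun y => Num.sqrt (g y)) (dg / (2 * Num.sqrt (g x))).
Proof.
move=> gx0 dgx; rewrite mulrC.
exact: (@is_derive1_comp R Num.sqrt g x _ _ (is_derive1_sqrt gx0) dgx).
Qed.

Lemma is_derive_affine (c d x : R) : is_derive x 1 (fun y => d + c * y) c.
Proof.
rewrite (_ : (fun y => _) = cst d + c \*: id)//.
by apply: is_derive_eq; rewrite add0r /GRing.scale/= mulr1.
Qed.

Lemma continuous_inv_sqrt (g : R -> R) (x : R) :
  0 < g x -> {for x, continuous g} ->
  {for x, continuous (fun y => (Num.sqrt (g y))^-1)}.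
Proof.
move=> gx cg; apply: cvgV; first by rewrite gt_eqF// sqrtr_gt0.
by apply: (@continuous_comp _ _ _ g Num.sqrt); [exact: cg|exact: sqrt_continuous].
Qed.

End line_integration.

(** * The area element of the Klein model *)

Section area_element.
Context {R : realType}.
Local Notation mu := (@lebesgue_measure R).
Local Notation plane := (measurableTypeR R * measurableTypeR R)%type.

Definition klein_density (p : R * R) : R := (Num.sqrt (- Defs.form p p) ^+ 3)^-1.

(** Extending the area element by 0 outside S makes the domain of integration
the whole plane, where Tonelli's theorem and changes of variables apply. *)
Definition density_on (S : set (R * R)) : R * R -> \bar R :=
  (fun p => (klein_density p)%:E) \_ S.

Lemma klein_density_ge0 p : 0 <= klein_density p.
Proof. by rewrite invr_ge0 exprn_ge0// sqrtr_ge0. Qed.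

Lemma measurable_form (c : R * R) :
  measurable_fun [set: plane] (fun p : plane => Defs.form c p).
Proof.
apply: measurable_funD; last first.
  by apply: measurable_funM => //; exact: measurable_snd.
apply: measurable_funD => //.
by apply: measurable_funM => //; exact: measurable_fst.
Qed.

Lemma measurable_form_diag :
  measurable_fun [set: plane] (fun p : plane => Defs.form p p).
Proof.
apply: measurable_funD; last first.
  by apply: measurable_funM; exact: measurable_snd.
apply: measurable_funD => //.
by apply: measurable_funM; exact: measurable_fst.
Qed.

Lemma measurable_klein_density :
  measurable_fun [set: plane] (klein_density : plane -> R).
Proof.
apply: measurable_inv_ge0 => [p|]; first by rewrite exprn_ge0// sqrtr_ge0.
apply: measurable_funX; apply: measurable_sqrt.
exact: (measurable_funN measurable_form_diag).
Qed.

Lemma density_on_ge0 S p : (0 <= density_on S p)%E.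
Proof.
rewrite /density_on patchE; case: ifPn => // _.
by rewrite lee_fin klein_density_ge0.
Qed.

Lemma measurable_density_on {S : set plane} : measurable S ->
  measurable_fun [set: plane] (density_on S : plane -> \bar R).
Proof.
move=> mS; apply/(measurable_restrictT _ mS).
apply/measurable_EFinP; apply: measurable_funTS; exact: measurable_klein_density.
Qed.

Lemma Vol_density_on (S : set (R * R)) :
  Vol S = (\int[(mu \x mu)%E]_p density_on S p)%E.
Proof. by rewrite /Vol integral_mkcond. Qed.

Lemma Vol_iterated (S : set plane) : measurable S ->
  Vol S = (\int[mu]_x \int[mu]_y density_on S (x, y))%E.
Proof.
move=> mS; rewrite Vol_density_on.
rewrite (fubini_tonelli1 (density_on S : plane -> _))//.
  exact: measurable_density_on.
exact: density_on_ge0.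
Qed.

End area_element.

(** * Measurability of half-planes and horodiscs *)

Section measurable_regions.
Context {R : realType}.
Local Notation plane := (measurableTypeR R * measurableTypeR R)%type.

Lemma measurable_le_set (f g : plane -> R) :
  measurable_fun [set: plane] f -> measurable_fun [set: plane] g ->
  measurable [set p : plane | f p <= g p].
Proof.
move=> mf mg; rewrite -(setTI [set _ | _]).
exact: measurable_fun_le.
Qed.

Lemma measurable_disc : measurable (@disc R : set plane).
Proof.
have -> : @disc R = ~` [set p : plane | 0 <= Defs.form p p].
  by apply/seteqP; split => p /=; rewrite /disc/= ltNge => /negP.
by apply: measurableC; apply: measurable_le_set => //; exact: measurable_form_diag.
Qed.

Lemma measurable_left_side (p q : plane) : measurable (left_side p q : set plane).
Proof.
apply: measurableI; first exact: measurable_disc.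
apply: measurable_le_set => //.
by apply: measurable_funB; apply: measurable_funM => //;
  apply: measurable_funB => //;
  (exact: measurable_snd || exact: measurable_fst).
Qed.

(** Clearing the denominator, positive on the disc, turns the condition into a
polynomial inequality. *)
Lemma measurable_horodisc (c m : plane) : measurable (horodisc c m : set plane).
Proof.
pose K := Defs.form c m ^+ 2 / - Defs.form m m.
have -> : horodisc c m = @disc R `&`
    [set p : plane | Defs.form c p ^+ 2 <= K * - Defs.form p p].
  by apply/seteqP; split => p [] dp /= h; split => //; move: h;
    rewrite ler_pdivrMr// oppr_gt0.
apply: measurableI; first exact: measurable_disc.
apply: measurable_le_set; first by apply: measurable_funX; exact: measurable_form.
by apply: measurable_funM => //; exact: (measurable_funN measurable_form_diag).
Qed.

End measurable_regions.

(** * Area in the coordinates of the pencil of lines through (0, 1) *)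

Section pencil.
Context {R : realType}.
Local Notation mu := (@lebesgue_measure R).
Local Notation plane := (measurableTypeR R * measurableTypeR R)%type.

(** The substitution x = (1 - y) k on the horizontal line of height y, with
Jacobian 1 - y, followed by an exchange of the integrations: the inner integral
now runs along a line through the ideal point (0, 1). *)
Lemma Vol_pencil (S : set plane) : measurable S ->
  (forall p, S p -> p.2 < 1) ->
  Vol S =
  (\int[mu]_k \int[mu]_y ((1 - y)%:E * density_on S ((1 - y) * k, y)%R))%E.
Proof.
move=> mS S1; rewrite Vol_density_on.
have mg := measurable_density_on mS.
rewrite (fubini_tonelli2 (density_on S : plane -> _))//; last exact: density_on_ge0.
have g0 x y : 1 <= y -> density_on S (x, y) = 0%E.
  move=> y1; rewrite /density_on patchE memNset// => /S1/=.
  by rewrite ltNge y1.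
(* exchange the two integrations, so that the slices become horizontal *)
rewrite (fubini_tonelli (fun p : plane =>
  (1 - p.2)%:E * density_on S ((1 - p.2) * p.1, p.2)%R)%E); last 2 first.
- apply: emeasurable_funM.
    apply/measurable_EFinP; apply: measurable_funB => //; exact: measurable_snd.
  apply: (measurableT_comp mg).
  apply: measurable_fun_pair; last exact: measurable_snd.
  apply: measurable_funM; last exact: measurable_fst.
  by apply: measurable_funB => //; exact: measurable_snd.
- move=> [k y]/=; have [y1|y1] := ltP y 1.
    by rewrite mule_ge0 ?density_on_ge0// lee_fin subr_ge0 ltW.
  by rewrite g0// mule0.
apply: eq_integral => y _; rewrite /fubini_G/=.
have mgy :
    measurable_fun [set: measurableTypeR R] (fun x => density_on S (x, y)).
  by apply: (measurableT_comp mg); exact: measurable_fun_pair.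
have [y1|y1] := ltP y 1.
  rewrite -(@ge0_integral_scale R (1 - y) (fun x => density_on S (x, y)))
    ?subr_gt0//; last first.
    by move=> x; exact: density_on_ge0.
  rewrite ge0_integralZl//.
  - by apply: (measurableT_comp mgy); exact: measurable_funM.
  - by move=> x _; exact: density_on_ge0.
  - by rewrite lee_fin subr_ge0 ltW.
rewrite integral0_eq; last by move=> x _; rewrite g0.
by rewrite integral0_eq// => x _; rewrite g0// mule0.
Qed.

(** In the half-plane coordinate Y this is the integral of dY / Y ^ 2 from
sqrt w to infinity.  With m = 1 - y, the antiderivative - 1 / Y is
- sqrt m / sqrt (2 - (1 + k ^ 2) m), which is continuous up to the ideal end
y = 1 although the integrand is not. *)
Lemma integral_geodesic_ray (k w : R) : 0 < w ->
  (\int[mu]_(y in `[(1 - 2 / (1 + k ^+ 2 + w))%R, 1%R[)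
     ((1 - y) * klein_density ((1 - y) * k, y))%:E = ((Num.sqrt w)^-1)%:E)%E.
Proof.
move=> w0.
pose c := 1 + k ^+ 2.
have c0 : 0 < c by rewrite /c ltr_pwDl// sqr_ge0.
set b := 1 - 2 / _.
have b1 : b < 1 by rewrite gtrBl divr_gt0// -/c addr_gt0.
have ib (x : R) : x \in `[b, 1[ -> 0 < 1 - x /\ 0 < 2 - c * (1 - x).
  rewrite in_itv/= /b => /andP[xb x1]; split; first by rewrite subr_gt0.
  have : (1 - x) * (c + w) <= 2.
    by rewrite -ler_pdivlMr; [rewrite lerBlDr -lerBlDl|rewrite addr_gt0].
  have : 0 < (1 - x) * w by rewrite mulr_gt0// subr_gt0.
  lra.
pose s y : R := Num.sqrt (1 - y).
pose t y : R := Num.sqrt (2 - c * (1 - y)).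
pose F y : R := - (s y * (t y)^-1).
pose f y : R := (s y * (t y * t y * t y))^-1.
have s0 (x : R) : x \in `[b, 1[ -> 0 < s x by move=> /ib[? _]; rewrite sqrtr_gt0.
have t0 (x : R) : x \in `[b, 1[ -> 0 < t x by move=> /ib[_ ?]; rewrite sqrtr_gt0.
have sE (x : R) : x \in `[b, 1[ -> 1 - x = s x ^+ 2.
  by move=> /ib[? _]; rewrite sqr_sqrtr// ltW.
have tE (x : R) : x \in `[b, 1[ -> 2 - c * (1 - x) = t x ^+ 2.
  by move=> /ib[_ ?]; rewrite sqr_sqrtr// ltW.
have fE (y : R) : y \in `[b, 1[ ->
    (1 - y) * klein_density ((1 - y) * k, y) = f y.
  move=> yb; rewrite /klein_density /Defs.form/=.
  rewrite (_ : - (_ + _) = (s y * t y) ^+ 2); last first.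
    by rewrite exprMn -sE// -tE// /c; ring.
  rewrite sqrtr_sqr gtr0_norm ?mulr_gt0 ?s0 ?t0// sE// /f.
  have := s0 _ yb; have := t0 _ yb => ty sy.
  by field; rewrite !gt_eqF.
transitivity (\int[mu]_(y in `[b, 1%R[) (f y)%:E)%E.
  by apply: eq_integral => y; rewrite inE/= => yb; rewrite fE.
have cs : continuous s.
  move=> x; apply: continuous_comp; last exact: sqrt_continuous.
  by apply: cvgB; [exact: cvg_cst|exact: cvg_id].
have ct : continuous t.
  move=> x; apply: continuous_comp; last exact: sqrt_continuous.
  apply: cvgB; first exact: cvg_cst.
  apply: cvgM; first exact: cvg_cst.
  by apply: cvgB; [exact: cvg_cst|exact: cvg_id].
transitivity ((0 - F b)%:E); last first.
  rewrite sub0r /F opprK.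
  have -> : t b = Num.sqrt w * s b.
    rewrite /t /s -sqrtrM ?(ltW w0)//; congr Num.sqrt.
    rewrite /b -/c; field; rewrite gt_eqF// addr_gt0//.
  congr (_%:E).
  have /s0 sb : b \in `[b, 1[ by rewrite in_itv/= lexx.
  by rewrite invfM mulrA mulrAC divff ?mul1r// gt_eqF.
apply: (@ge0_is_derive_FTC2_bndo R f F b 1 0 b1).
- by move=> x xb; rewrite invr_ge0 !mulr_ge0 ?sqrtr_ge0.
- move=> x xb.
  have dt : is_derive x 1 t (c / (2 * t x)).
    apply: is_derive_sqrt_comp; first by have [] := ib x xb.
    rewrite (_ : (fun y => _) = (fun y => (2 - c) + c * y)).
      exact: is_derive_affine.
    by apply/funext => y; ring.
  have ds : is_derive x 1 s (-1 / (2 * s x)).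
    apply: is_derive_sqrt_comp; first by have [] := ib x xb.
    rewrite (_ : (fun y => _) = (fun y => 1 + (-1) * y)).
      exact: is_derive_affine.
    by apply/funext => y; ring.
  have tx := t0 x xb; have sx := s0 x xb.
  have tx0 : t x != 0 by rewrite gt_eqF.
  have dV := is_deriveV tx0 dt.
  apply: (@is_derive_eq _ _ _ _ _ _ _ _ (is_deriveN (is_deriveM ds dV))).
  rewrite /f /GRing.scale/=.
  have := tE x xb; rewrite sE// => E.
  have -> : c = (2 - t x ^+ 2) / s x ^+ 2.
    by apply: (canRL (mulfK _)); [rewrite gt_eqF ?exprn_gt0|rewrite -E; ring].
  by field; rewrite !gt_eqF.
- move=> x xb; apply: cvgV.
    by rewrite gt_eqF// !mulr_gt0 ?s0 ?t0.
  by apply: cvgM; [exact: cs|apply: cvgM; [apply: cvgM; exact: ct|exact: ct]].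
- apply: cvg_at_left_filter.
  have -> : 0 = F 1 by rewrite /F /s subrr sqrtr0 mul0r oppr0.
  apply: cvgN; apply: cvgM; first exact: cs.
  apply: cvgV; last exact: ct.
  by rewrite /t subrr mulr0 subr0 gt_eqF// sqrtr_gt0.
Qed.

(** The condition (1 - y) (1 + k ^ 2 + w k) <= 2 says Y ^ 2 >= w k for the
half-plane height Y of the point; each vertical ray contributes
1 / sqrt (w k). *)
Lemma Vol_above_graph (B : R) (w : R -> R) (S : set plane) : measurable S ->
  (forall p, S p -> p.2 < 1) ->
  (forall k : R, 0 <= k <= B -> 0 < w k) ->
  (forall k y : R, y < 1 ->
    S ((1 - y) * k, y) <-> 0 <= k <= B /\ (1 - y) * (1 + k ^+ 2 + w k) <= 2) ->
  Vol S = (\int[mu]_(k in `[0%R, B]) ((Num.sqrt (w k))^-1)%:E)%E.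
Proof.
move=> mS S1 w0 SE; rewrite Vol_pencil// [RHS]integral_mkcond.
apply: eq_integral => k _; rewrite patchE.
case: ifPn => [/set_mem/=|/negP kB]; last first.
  apply: integral0_eq => y _; rewrite /density_on patchE memNset ?mule0//= => Sk.
  by apply: kB; rewrite inE/= in_itv/=; have [] := (SE k y (S1 _ Sk)).1 Sk.
rewrite in_itv/= => kB; have wk := w0 k kB.
rewrite -(integral_geodesic_ray k (w k) wk) [RHS]integral_mkcond.
apply: eq_integral => y _; rewrite /density_on !patchE.
have dk : 0 < 1 + k ^+ 2 + w k.
  by rewrite addr_gt0// ltr_pwDl// sqr_ge0.
have -> : (y \in `[(1 - 2 / (1 + k ^+ 2 + w k)), 1[%classic) =
    ((((1 - y) * k, y) : plane) \in S).
  apply/idP/idP; rewrite !inE/= in_itv/=.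
    move=> /andP[yk y1]; apply/SE => //; split=> //.
    by rewrite -ler_pdivlMr// lerBlDr -lerBlDl.
  move=> Sk; have y1 : y < 1 by exact: (S1 _ Sk).
  move/SE : Sk => -[]// _; rewrite -ler_pdivlMr// lerBlDr -lerBlDl => ->//=.
by case: ifPn => _; rewrite ?mule0// -EFinM.
Qed.

Lemma form_pencil (k y : R) :
  - Defs.form ((1 - y) * k, y) ((1 - y) * k, y) =
  (1 - y) * (2 - (1 - y) * (1 + k ^+ 2)).
Proof. by rewrite /Defs.form/=; ring. Qed.

Lemma disc_pencil (k y : R) : y < 1 ->
  disc ((1 - y) * k, y) <-> (1 - y) * (1 + k ^+ 2) < 2.
Proof.
by move=> y1; rewrite /disc/= -oppr_gt0 form_pencil pmulr_rgt0 ?subr_gt0.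
Qed.

Lemma sides_pencil (a k y : R) : 0 < a -> y < 1 ->
  (0 <= (1 - y) * k /\ a * ((1 - y) * k) <= 1 - y) <-> 0 <= k <= a^-1.
Proof.
move=> a0 y1; have m0 : 0 < 1 - y by rewrite subr_gt0.
rewrite pmulr_rge0// mulrCA ger_pMr// mulrC -ler_pdivlMr// div1r.
by split => [[-> ->]//|/andP[]].
Qed.

End pencil.

(** * The sides of the quadrilateral *)

Section sides.
Context {R : realType}.

Lemma disc_snd_lt1 {p : R * R} : disc p -> p.2 < 1.
Proof.
rewrite /disc /Defs.form/= => dp; rewrite ltNge; apply/negP => p2.
by have := sqr_ge0 p.1; nra.
Qed.

Lemma left_side_A0A1 {p : R * R} : disc p ->
  left_side (A0 R) (A1 R) p <-> 0 <= p.1.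
Proof.
move=> dp; rewrite /left_side /orient/=.
have -> : (0 - 0) * (p.2 - 1) - (0 - 1) * (p.1 - 0) = p.1 by ring.
by split => // -[].
Qed.

Lemma left_side_P0A0 {a : R} {p : R * R} : 0 < a -> disc p ->
  left_side (P0 a) (A0 R) p <-> a * p.1 <= 1 - p.2.
Proof.
move=> a0 dp; rewrite /left_side /orient/=.
have -> : (0 - a) * (p.2 - (1 - a ^+ 2)) - (1 - (1 - a ^+ 2)) * (p.1 - a) =
   a * (1 - p.2 - a * p.1) by ring.
rewrite pmulr_rge0// subr_ge0.
by split => // -[].
Qed.

Lemma left_side_A1P1 {a : R} {p : R * R} : 0 < a -> disc p ->
  left_side (A1 R) (P1 a) p <-> 0 <= p.2.
Proof.
move=> a0 dp; rewrite /left_side /orient/=.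
have -> : (a - 0) * (p.2 - 0) - (0 - 0) * (p.1 - 0) = a * p.2 by ring.
rewrite pmulr_rge0//.
by split => // -[].
Qed.

Lemma left_side_P1P0 {a : R} {p : R * R} : 0 < a < 1 -> disc p ->
  left_side (P1 a) (P0 a) p <-> p.1 <= a.
Proof.
move=> a01 dp; rewrite /left_side /orient/=.
have -> : (a - a) * (p.2 - 0) - (1 - a ^+ 2 - 0) * (p.1 - a) =
   (1 - a ^+ 2) * (a - p.1) by ring.
rewrite pmulr_rge0 ?subr_ge0//; last by nra.
by split => // -[].
Qed.

End sides.

(** * The area of the horocycle piece *)

Section horocycle.
Context {R : realType}.

Lemma form_M (a t : R) :
  - Defs.form (M a t) (M a t) = t * a ^+ 2 * (2 - t - t * a ^+ 2).
Proof. by rewrite /Defs.form/=; ring. Qed.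

Lemma horodisc_ratio_M (a t : R) : 0 < a < 1 -> 0 < t <= 1 ->
  Defs.form (A0 R) (M a t) ^+ 2 / - Defs.form (M a t) (M a t) =
  t * a ^+ 2 / (2 - t - t * a ^+ 2).
Proof.
move=> a01 t01; have ta : 0 < t * a ^+ 2 by rewrite mulr_gt0 ?exprn_gt0//; lra.
have d0 : 0 < 2 - t - t * a ^+ 2 by have : a ^+ 2 < 1; nra.
rewrite form_M (_ : Defs.form _ _ = - (t * a ^+ 2)); last first.
  by rewrite /Defs.form/=; ring.
by rewrite sqrrN expr2 -mulf_div divff ?mul1r// gt_eqF.
Qed.

(** In the half-plane with A0 at infinity the piece is the half-strip of width
1 / a above a horizontal line. *)
Lemma Vol_horocycle_piece (a t : R) : 0 < a < 1 -> 0 < t <= 1 ->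
  Vol (horocycle_piece a t) = (Num.sqrt (t / (2 - t - t * a ^+ 2)))%:E.
Proof.
move=> a01 t01; have a0 : 0 < a by case/andP: a01.
have t0 : 0 < t by case/andP: t01.
have d0 : 0 < 2 - t - t * a ^+ 2.
  have a2 : a ^+ 2 < 1 by nra.
  by nra.
(* the reciprocal of the level of the horocycle, so that sqrt w is its height *)
pose w : R := (2 - t - t * a ^+ 2) / (t * a ^+ 2).
have w0 : 0 < w by rewrite divr_gt0// mulr_gt0// exprn_gt0.
rewrite (@Vol_above_graph R a^-1 (fun=> w)); last 4 first.
- apply: measurableI; last exact: measurable_left_side.
  apply: measurableI; last exact: measurable_left_side.
  exact: measurable_horodisc.
- by move=> p [[[dp _] _] _]; exact: disc_snd_lt1.
- by [].
- move=> k y y1.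
  have m0 : 0 < 1 - y by rewrite subr_gt0.
  rewrite /horocycle_piece /horodisc horodisc_ratio_M//=.
  have -> : t * a ^+ 2 / (2 - t - t * a ^+ 2) = w^-1 by rewrite /w invf_div.
  have fA : Defs.form (A0 R) ((1 - y) * k, y) ^+ 2 = (1 - y) ^+ 2.
    by rewrite /Defs.form/=; ring.
  have dE := disc_pencil k y y1.
  have horoE : (1 - y) * (1 + k ^+ 2) < 2 ->
     ((1 - y) ^+ 2 / ((1 - y) * (2 - (1 - y) * (1 + k ^+ 2))) <= w^-1) =
     ((1 - y) * (1 + k ^+ 2 + w) <= 2).
    move=> d; rewrite ler_pdivrMr ?mulr_gt0 ?subr_gt0//.
    rewrite mulrCA expr2 ler_pM2l// mulrC ler_pdivlMr//.
    by rewrite lerBrDr -mulrDr (addrC w).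
  have kE := sides_pencil a k y a0 y1.
  rewrite fA form_pencil; split.
  + move=> [[[dp h] l1] l2]; split.
      by apply/kE; split; [apply/(left_side_A0A1 dp)|apply/(left_side_P0A0 a0 dp)].
    by rewrite -horoE//; exact/dE.
  + move=> [/kE[k0 ka] h].
    have dp : disc ((1 - y) * k, y).
      by apply/dE; apply: lt_le_trans h; rewrite ltr_pM2l// ltrDl.
    split; last exact/(left_side_P0A0 a0 dp).
    split; last exact/(left_side_A0A1 dp).
    by split => //; rewrite horoE//; exact/dE.
rewrite integral_cst//= lebesgue_measure_itv/= lte_fin invr_gt0 a0.
rewrite -EFinB subr0 -EFinM -sqrtrV ?(ltW w0)// invf_div.
have -> : t * a ^+ 2 / (2 - t - t * a ^+ 2) = (t / (2 - t - t * a ^+ 2)) * a ^+ 2.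
  by rewrite mulrAC.
rewrite sqrtrM; last by rewrite divr_ge0// ltW.
by rewrite sqrtr_sqr gtr0_norm// mulfK// gt_eqF.
Qed.

End horocycle.

(** * The area of the Lambert quadrilateral *)

Section Lambert.
Context {R : realType}.
Local Notation mu := (@lebesgue_measure R).

Lemma asinN (x : R) : -1 <= x <= 1 -> asin (- x) = - asin x.
Proof.
move=> x1; rewrite -{1}(@asinK R x) ?in_itv//= -sinN sinK// in_itv/=.
by have := asin_lepi2 x1; have := asin_geNpi2 x1; lra.
Qed.

Lemma asin0 : asin 0 = 0 :> R.
Proof. by rewrite -{1}(sin0 R) sinK// in_itv/=; have := pi_gt0 R; lra. Qed.

Lemma asin_ge0 (x : R) : 0 <= x <= 1 -> 0 <= asin x.
Proof.
move=> x01; have xB : -1 <= x <= 1 by lra.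
rewrite leNgt; apply/negP => s0.
have : 0 < sin (- asin x).
  apply: sin_gt0_pi; have := asin_geNpi2 xB; have := pi_gt0 R; lra.
by rewrite sinN asinK ?in_itv//=; lra.
Qed.

(** sqrt (1 - a ^ 2) is the cosine of asin a, that is the sine of the
complementary angle. *)
Lemma asinD_sqrt (a : R) : 0 < a < 1 ->
  asin a + asin (Num.sqrt (1 - a ^+ 2)) = pi / 2.
Proof.
move=> a01; have aB : -1 <= a <= 1 by lra.
rewrite -cos_asin// -[cos _]opprK -sinBpihalf -sinN opprB sinK.
  by rewrite addrCA subrr addr0.
rewrite in_itv/=.
have := asin_lepi2 aB; have := pi_gt0 R.
have : 0 <= asin a by rewrite asin_ge0//; lra.
by lra.
Qed.

(** The part of the quadrilateral above the geodesic A1P1, which is the unit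
half-circle in the half-plane. *)
Lemma integral_Lambert_inner (a : R) : 0 < a < 1 ->
  (\int[mu]_(k in `[0%R, a]) ((Num.sqrt (1 - k ^+ 2))^-1)%:E = (asin a)%:E)%E.
Proof.
move=> a01.
rewrite -[RHS](_ : (asin a - asin 0)%:E = _); last by rewrite asin0 subr0.
apply: is_derive_FTC2; first lra.
- move=> x; rewrite in_itv/= => xa.
  by apply: is_derive1_asin; lra.
- move=> x; rewrite in_itv/= => xa; apply: continuous_inv_sqrt; first nra.
  by apply: cvgB; [exact: cvg_cst|exact: exprn_continuous].
Qed.

(** The part above the geodesic P1P0, the half-circle of centre 1 / a and radius
d with d ^ 2 = 1 / a ^ 2 - 1; u is the coordinate centred and scaled
accordingly. *)
Lemma integral_Lambert_outer (a : R) : 0 < a < 1 ->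
  (\int[mu]_(k in `[a, a^-1%R])
     ((Num.sqrt (2 * k / a - (1 + k ^+ 2)))^-1)%:E =
  (asin (Num.sqrt (1 - a ^+ 2)))%:E)%E.
Proof.
move=> a01; have a0 : 0 < a by case/andP: a01.
have aV : a * a^-1 = 1 by rewrite divff// gt_eqF.
have V0 : 0 < a^-1 by rewrite invr_gt0.
have a1 : 0 < 1 - a ^+ 2 by nra.
have [d [dD d0 dE]] : exists d, [/\ d = Num.sqrt (1 - a ^+ 2) / a, 0 < d &
    d ^+ 2 = a^-1 ^+ 2 - 1].
  exists (Num.sqrt (1 - a ^+ 2) / a); split => //.
    by rewrite divr_gt0// sqrtr_gt0.
  by rewrite expr_div_n sqr_sqrtr ?(ltW a1)//; field; rewrite gt_eqF.
pose u x : R := - (a^-1 / d) + d^-1 * x.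
have uE x : u x = (x - a^-1) / d by rewrite /u; ring.
have uB x : x \in `[a, a^-1] -> -1 < u x < 1.
  rewrite in_itv/= => xa; rewrite uE ltr_pdivlMr// ltr_pdivrMr// mulN1r mul1r.
  apply/andP; split; last lra.
  rewrite ltrNl opprB.
  rewrite -(@ltr_pXn2r R 2)// ?nnegrE ?(ltW d0)//; last lra.
  rewrite dE; nra.
have fE x : d ^+ 2 * (1 - u x ^+ 2) = 2 * x / a - (1 + x ^+ 2).
  rewrite uE expr_div_n mulrBr mulr1 mulrCA divff ?mulr1; last first.
    by rewrite gt_eqF ?exprn_gt0.
  by rewrite dE; ring.
pose F (x : R) : R := asin (u x).
rewrite -[RHS](_ : (F a^-1 - F a)%:E = _); last first.
  rewrite /F !uE subrr mul0r asin0 sub0r -asinN. congr (EFin (asin _)).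
    rewrite -mulNr opprB.
    apply: (canLR (mulfK _)); first by rewrite gt_eqF.
    by rewrite dD mulrA -expr2 sqr_sqrtr ?(ltW a1)//; field; rewrite gt_eqF.
  by have := uB a; rewrite uE in_itv/= lexx/=; nra.
apply: is_derive_FTC2.
- by nra.
- move=> x xa.
  have := uB x xa => uxB.
  apply: (@is_derive_eq _ _ _ _ _ _ _ _ (@is_derive1_comp R asin u x _ _
    (is_derive1_asin uxB) (is_derive_affine _ _ _))).
  by rewrite -fE sqrtrM ?sqr_ge0// sqrtr_sqr gtr0_norm// invfM mulrC.
- move=> x xa; apply: continuous_inv_sqrt.
    rewrite -fE mulr_gt0 ?exprn_gt0//; have := uB x xa; nra.
  apply: cvgB; last by apply: cvgD; [exact: cvg_cst|exact: exprn_continuous].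
  by apply: cvgM; [apply: cvgM; [exact: cvg_cst|exact: cvg_id]|exact: cvg_cst].
Qed.

(** Both lower sides become half-circles; the region lies above the higher one,
hence the maximum in w, and they cross over k = a, the line A0P1. *)
Lemma Vol_Lambert_quad (a : R) : 0 < a < 1 ->
  Vol (Lambert_quad a) = (pi / 2)%:E.
Proof.
move=> a01; have a0 : 0 < a by case/andP: a01.
have a1 : a < 1 by case/andP: a01.
have aV : a * a^-1 = 1 by rewrite divff// gt_eqF.
have V0 : 0 < a^-1 by rewrite invr_gt0.
(* the larger of 1 - k ^ 2 and 2 k / a - 1 - k ^ 2 *)
pose w (k : R) : R := Num.max 2 (2 * k / a) - (1 + k ^+ 2).
have w0 k : 0 <= k <= a^-1 -> 0 < w k.
  move=> kB; rewrite /w subr_gt0 lt_max.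
  have [k1|k1] := ltP k 1; apply/orP; [left|right]; first nra.
  have : k * k <= k / a by rewrite ler_pM2l; lra.
  have : k < k / a by rewrite ltr_pMr ?invf_gt1//; lra.
  by rewrite -mulrA; nra.
rewrite (@Vol_above_graph R a^-1 w); last 4 first.
- by do 3 ?[apply: measurableI; last exact: measurable_left_side];
    exact: measurable_left_side.
- by move=> p [[[[dp _] _] _] _]; exact: disc_snd_lt1.
- exact: w0.
- move=> k y y1.
  have m0 : 0 < 1 - y by rewrite subr_gt0.
  have dE := disc_pencil k y y1.
  have kE := sides_pencil a k y a0 y1.
  have wE : (1 - y) * (1 + k ^+ 2 + w k) <= 2 <-> 0 <= y /\ (1 - y) * k <= a.
    have -> : 1 + k ^+ 2 + w k = Num.max 2 (2 * k / a).
      by rewrite /w addrC subrK.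
    rewrite (maxr_pMr _ _ (ltW m0)) ge_max.
    rewrite (_ : (1 - y) * (2 * k / a) = 2 * ((1 - y) * k) / a); last first.
      by ring.
    rewrite ler_pdivrMr// ler_pM2l//.
    by split => [/andP[]|[]]; [split|move=> ? ->; rewrite andbT]; lra.
  rewrite /Lambert_quad; split.
  + move=> [[[[dp l1] [_ l2]] [_ l3]] [_ l4]].
    split.
      by apply/kE; split; [apply/(left_side_A0A1 dp)|apply/(left_side_P0A0 a0 dp)].
    by apply/wE; split; [apply/(left_side_A1P1 a0 dp)|apply/(left_side_P1P0 a01 dp)].
  + move=> [/[dup] kB /kE[k0 ka] /[dup] h /wE[y0 xa]].
    have dp : disc ((1 - y) * k, y).
      apply/dE; apply: lt_le_trans h; rewrite ltr_pM2l// ltrDl.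
      exact: w0.
    split; last exact/(left_side_P0A0 a0 dp).
    split; last exact/(left_side_P1P0 a01 dp).
    by split; [exact/(left_side_A0A1 dp)|exact/(left_side_A1P1 a0 dp)].
have f0 k : 0 <= (Num.sqrt (w k))^-1 by rewrite invr_ge0 sqrtr_ge0.
have mf : measurable_fun [set: R] (fun k => (Num.sqrt (w k))^-1).
  apply: measurable_inv_ge0 => [x|]; first exact: sqrtr_ge0.
  apply: measurable_sqrt; apply: measurable_funB; last first.
    by apply: measurable_funD => //; exact: measurable_funX.
  by apply: measurable_maxr => //; apply: measurable_funM.
have aV1 : a <= a^-1 by nra.
rewrite (integral_itv_split _ _ _ _ (ltW a0) aV1 f0 mf).
rewrite -(asinD_sqrt a a01) EFinD -integral_Lambert_inner// -integral_Lambert_outer//.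
congr (_ + _)%E; apply: eq_integral => k; rewrite inE/= in_itv/= => kB.
  rewrite /w max_l; first by congr ((Num.sqrt _)^-1)%:E; ring.
  by rewrite ler_pdivrMr//; lra.
rewrite /w max_r//.
by rewrite ler_pdivlMr//; lra.
Qed.

End Lambert.

(** * Distance to the base line *)

Section distance.
Context {R : realType}.

Lemma le_arccosh (x y : R) : 1 <= x -> 1 <= y ->
  (arccosh x <= arccosh y) = (x <= y).
Proof.
move=> x1 y1; rewrite /arccosh ler_ln ?posrE; last 2 first.
- by rewrite ltr_pwDl ?sqrtr_ge0//; lra.
- by rewrite ltr_pwDl ?sqrtr_ge0//; lra.
have mono (u v : R) : 1 <= u -> u <= v ->
    Num.sqrt (u ^+ 2 - 1) <= Num.sqrt (v ^+ 2 - 1).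
  by move=> u1 uv; rewrite ler_wsqrtr//; nra.
apply/idP/idP => [|xy]; last by rewrite lerD// mono.
by rewrite !leNgt; apply: contra => yx; have := mono y x y1 (ltW yx); lra.
Qed.

Lemma inf_eq_min (E : set R) (c : R) :
  E c -> (forall x, E x -> c <= x) -> inf E = c.
Proof.
move=> Ec Elb; apply/eqP; rewrite eq_le; apply/andP; split.
  by apply: ge_inf => //; exists c.
by apply: lb_le_inf; [exists c|].
Qed.

(** The infimum is attained at the foot (p.1, 0) of the perpendicular: by
(1 - p.1 x) ^ 2 - (1 - p.1 ^ 2) (1 - x ^ 2) = (p.1 - x) ^ 2 no other point
(x, 0) of the line is nearer. *)
Lemma hdist_line_axis (a : R) (p : R * R) : 0 < a -> disc p ->
  hdist_line p (hline (A1 R) (P1 a)) =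
  arccosh (Num.sqrt ((1 - p.1 ^+ 2) / - Defs.form p p)).
Proof.
move=> a0 dp; have D0 : 0 < - Defs.form p p by rewrite oppr_gt0.
have e0 : 0 < 1 - p.1 ^+ 2.
  by move: D0; rewrite /Defs.form; have := sqr_ge0 p.2; lra.
have LE (r : R * R) : hline (A1 R) (P1 a) r <-> r.1 ^+ 2 < 1 /\ r.2 = 0.
  rewrite /hline /disc /orient /Defs.form/=.
  have -> : (a - 0) * (r.2 - 0) - (0 - 0) * (r.1 - 0) = a * r.2 by ring.
  split=> [[dr /eqP]|[r1 ->]]; last by rewrite !mulr0; split => //; lra.
  by rewrite mulf_eq0 gt_eqF//= => /eqP r2; split => //; move: dr; rewrite r2; lra.
have ratio1 (x : R) : x ^+ 2 < 1 ->
    (1 - p.1 ^+ 2) / - Defs.form p p <=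
    (- Defs.form p (x, 0) /
      Num.sqrt (Defs.form p p * Defs.form (x, 0) (x, 0))) ^+ 2.
  move=> x1.
  have fx : Defs.form (x, 0) (x, 0) = - (1 - x ^+ 2) by rewrite /Defs.form/=; ring.
  have d0 : 0 < 1 - x ^+ 2 by lra.
  rewrite fx expr_div_n sqr_sqrtr; last by rewrite mulrN -mulNr mulr_ge0// ltW.
  rewrite mulrN -mulNr invfM mulrA -mulrA (mulrC (_^-1)) mulrA.
  rewrite ler_pM2r ?invr_gt0//.
  rewrite ler_pdivlMr// /Defs.form/=.
  by have := sqr_ge0 (p.1 - x); lra.
have ratio_ge1 : 1 <= Num.sqrt ((1 - p.1 ^+ 2) / - Defs.form p p).
  rewrite -[1 as X in X <= _]sqrtr1 ler_wsqrtr// ler_pdivlMr// mul1r /Defs.form.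
  by have := sqr_ge0 p.2; lra.
have ratio_le (x : R) : x ^+ 2 < 1 ->
    Num.sqrt ((1 - p.1 ^+ 2) / - Defs.form p p) <=
    - Defs.form p (x, 0) / Num.sqrt (Defs.form p p * Defs.form (x, 0) (x, 0)).
  move=> x1; rewrite -[leRHS]ger0_norm.
    by rewrite -sqrtr_sqr ler_wsqrtr// ratio1.
  rewrite divr_ge0// ?sqrtr_ge0// /Defs.form/=.
  by have := sqr_ge0 (p.1 - x); lra.
apply: inf_eq_min.
- exists (p.1, 0).
    by apply/LE; split => //; lra.
  rewrite /hdist; congr arccosh.
  have -> : Defs.form (p.1, 0) (p.1, 0) = - (1 - p.1 ^+ 2).
    by rewrite /Defs.form/=; ring.
  have -> : - Defs.form p (p.1, 0) = 1 - p.1 ^+ 2 by rewrite /Defs.form/=; ring.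
  rewrite mulrN -mulNr !sqrtrM ?(ltW D0) ?(ltW e0)// sqrtrV ?(ltW D0)//.
  rewrite -{1}(sqr_sqrtr (ltW e0)) invfM mulrCA expr2 mulfK ?gt_eqF ?sqrtr_gt0//.
  by rewrite mulrC.
- move=> _ [[x y] /LE/= [x1 ->] <-]; rewrite /hdist le_arccosh//.
    exact: ratio_le.
  exact/(le_trans ratio_ge1)/ratio_le.
Qed.

(** For p = (x, y), the quotient y ^ 2 / (1 - x ^ 2 - y ^ 2) is the square of the
hyperbolic sine of the distance from p to the line. *)
Lemma le_hdist_line_axis (a : R) (p q : R * R) : 0 < a -> disc p -> disc q ->
  (hdist_line p (hline (A1 R) (P1 a)) <= hdist_line q (hline (A1 R) (P1 a))) =
  (p.2 ^+ 2 / - Defs.form p p <= q.2 ^+ 2 / - Defs.form q q).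
Proof.
move=> a0 dp dq; rewrite !hdist_line_axis//.
have E (r : R * R) : disc r ->
    (1 - r.1 ^+ 2) / - Defs.form r r = 1 + r.2 ^+ 2 / - Defs.form r r.
  move=> dr; have D0 : 0 < - Defs.form r r by rewrite oppr_gt0.
  apply: (canLR (mulfK _)); first by rewrite gt_eqF.
  rewrite mulrDl divfK ?gt_eqF// /Defs.form; ring.
have ge0 (r : R * R) : disc r -> 0 <= r.2 ^+ 2 / - Defs.form r r.
  by move=> dr; rewrite divr_ge0 ?sqr_ge0// oppr_ge0 ltW.
have ge1 (r : R * R) : disc r -> 1 <= 1 + r.2 ^+ 2 / - Defs.form r r.
  by move=> dr; rewrite lerDl ge0.
rewrite !E// le_arccosh; last 2 first.
- by rewrite -[leLHS]sqrtr1 ler_wsqrtr// ge1.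
- by rewrite -[leLHS]sqrtr1 ler_wsqrtr// ge1.
by rewrite ler_sqrt ?lerD2l// (le_trans ler01)// ge1.
Qed.

End distance.

(** * The length of the base segment *)

Section base_length.
Context {R : realType}.
Local Notation mu := (@lebesgue_measure R).

(** This is artanh a, the hyperbolic length of the segment from (0, 0) to
(a, 0). *)
Definition half_log_ratio (a : R) : R := (ln (1 + a) - ln (1 - a)) / 2.

Lemma integral_half_log_ratio (a : R) : 0 <= a < 1 ->
  (\int[mu]_(x in `[0%R, a]) ((1 - x ^+ 2)^-1)%:E = (half_log_ratio a)%:E)%E.
Proof.
move=> a01.
rewrite -[RHS](_ : (half_log_ratio a - half_log_ratio 0)%:E = _); last first.
  by rewrite [X in _ - X]/half_log_ratio addr0 subr0 subrr mul0r subr0.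
apply: (@is_derive_FTC2 R (fun x => (1 - x ^+ 2)^-1)); first by case/andP: a01.
- move=> x; rewrite in_itv/= => xa.
  have p0 : 0 < 1 + x by lra.
  have m0 : 0 < 1 - x by lra.
  pose p (y : R) : R := 1 + 1 * y; pose m (y : R) : R := 1 + (-1) * y.
  have pE y : p y = 1 + y by rewrite /p mul1r.
  have mE y : m y = 1 - y by rewrite /m mulN1r.
  have px : 0 < p x by rewrite pE.
  have mx : 0 < m x by rewrite mE.
  have dp := @is_derive1_comp R (@ln R) p x _ _
    (is_derive1_ln px) (is_derive_affine 1 1 x).
  have dm := @is_derive1_comp R (@ln R) m x _ _
    (is_derive1_ln mx) (is_derive_affine (-1) 1 x).
  rewrite (_ : half_log_ratio =
    2^-1 \*: ((@ln R \o p) - (@ln R \o m))); last first.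
    apply/funext => y; rewrite /half_log_ratio -pE -mE.
    by rewrite mulrC.
  apply: (@is_derive_eq _ _ _ _ _ _ _ _ (is_deriveZ 2^-1 (is_deriveB dp dm))).
  rewrite /GRing.scale/= pE mE; field.
  by rewrite !gt_eqF//=; nra.
- move=> x; rewrite in_itv/= => xa; apply: cvgV; first by rewrite gt_eqF//; nra.
  by apply: cvgB; [exact: cvg_cst|exact: exprn_continuous].
Qed.

Lemma measurable_inv_1Bsqr (a : R) : a < 1 ->
  measurable_fun `[0, a] (fun x : R => (1 - x ^+ 2)^-1).
Proof.
move=> a1; apply: subspace_continuous_measurable_fun => //.
apply: continuous_in_subspaceT => x; rewrite inE/= in_itv/= => xa.
apply: cvgV; first by rewrite gt_eqF//; nra.
by apply: cvgB; [exact: cvg_cst|exact: exprn_continuous].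
Qed.

Lemma half_log_ratio_le (a : R) : 0 < a < 1 ->
  half_log_ratio a <= a / (1 - a ^+ 2).
Proof.
move=> a01; have a0 : 0 < a by case/andP: a01.
have d0 : 0 < 1 - a ^+ 2 by nra.
rewrite -lee_fin -integral_half_log_ratio; last lra.
apply: (@le_trans _ _
    (\int[mu]_(x in `[0%R, a]) cst (1 - a ^+ 2)^-1%:E x)%E).
  apply: ge0_le_integral => //=.
  - move=> x; rewrite in_itv/= => xa; rewrite lee_fin invr_ge0; nra.
  - by apply/measurable_EFinP; apply: measurable_inv_1Bsqr; lra.
  - move=> x; rewrite in_itv/= => xa; rewrite lee_fin lef_pV2 ?posrE; nra.
rewrite integral_cst//= lebesgue_measure_itv/= lte_fin a0 -EFinB subr0 -EFinM.
by rewrite mulrC.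
Qed.

(** The first terms of 1 / (1 - x ^ 2) = 1 + x ^ 2 + x ^ 4 + ... integrated. The
term of degree 5 is needed later: without it the lower bound on the density
fails for a close to 1. *)
Lemma half_log_ratio_ge (a : R) : 0 < a < 1 ->
  a + a ^+ 3 / 3 + a ^+ 5 / 5 <= half_log_ratio a.
Proof.
move=> a01; have a0 : 0 < a by case/andP: a01.
pose F (x : R) : R := x + x ^+ 3 / 3 + x ^+ 5 / 5.
pose f (x : R) : R := 1 + x ^+ 2 + x ^+ 4.
have dF (x : R) : is_derive x 1 F (f x).
  rewrite (_ : F =
    (@id R) + 3^-1 \*: (@id R) ^+ 3 + 5^-1 \*: (@id R) ^+ 5); last first.
    by apply/funext => y; rewrite /F mulrC (mulrC (y ^+ 5)).
  by apply: is_derive_eq; rewrite /GRing.scale/= /f; field.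
have cf : continuous f.
  move=> x; apply: cvgD; last exact: exprn_continuous.
  by apply: cvgD; [exact: cvg_cst|exact: exprn_continuous].
rewrite -lee_fin -integral_half_log_ratio; last lra.
have FE : F a - F 0 = F a by rewrite /F !expr0n/=; ring.
rewrite -/(F a) -FE -(@is_derive_FTC2 R f F 0 a (ltW a0)
  (fun x _ => dF x) (fun x _ => cf x)).
apply: ge0_le_integral => //=.
- by move=> x _; rewrite lee_fin !addr_ge0// ?exprn_even_ge0.
- by apply/measurable_EFinP; apply: measurable_funTS; exact: continuous_measurable_fun.
- by apply/measurable_EFinP; apply: measurable_inv_1Bsqr; lra.
- move=> x; rewrite in_itv/= => xa; rewrite lee_fin.
  have x2 : 0 < 1 - x ^+ 2 by nra.
  rewrite -[leRHS]mul1r ler_pdivlMr//.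
  have -> : f x * (1 - x ^+ 2) = 1 - x ^+ 6 by rewrite /f; ring.
  by rewrite gerBl exprn_even_ge0.
Qed.

End base_length.

(** * The area of the hypercycle piece *)

Section hypercycle.
Context {R : realType}.
Local Notation mu := (@lebesgue_measure R).
Local Notation plane := (measurableTypeR R * measurableTypeR R)%type.

(** The antiderivative y / (e sqrt (e - y ^ 2)) vanishes at 0, and at the upper
end e - y ^ 2 = e / (1 + C ^ 2). *)
Lemma integral_equidistant_slice (e C : R) : 0 < e -> 0 <= C ->
  (\int[mu]_(y in `[0%R, (C * Num.sqrt (e / (1 + C ^+ 2)))%R])
     ((Num.sqrt (e - y ^+ 2) ^+ 3)^-1)%:E = (C / e)%:E)%E.
Proof.
move=> e0 C0; pose h := Num.sqrt (e / (1 + C ^+ 2)).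
have c0 : 0 < 1 + C ^+ 2 by rewrite ltr_pwDl// sqr_ge0.
have hE : h ^+ 2 = e / (1 + C ^+ 2) by rewrite sqr_sqrtr// divr_ge0 ?ltW.
have h0 : 0 < h by rewrite sqrtr_gt0 divr_gt0.
have YE : e - (C * h) ^+ 2 = h ^+ 2.
  by rewrite exprMn hE; field; rewrite gt_eqF.
have iY (y : R) : y \in `[0, C * h] -> 0 < e - y ^+ 2.
  rewrite in_itv/= => /andP[y0 yY].
  have : 0 < h ^+ 2 by rewrite exprn_gt0.
  by rewrite -YE; nra.
pose s (y : R) : R := Num.sqrt (e - y ^+ 2).
pose F (y : R) : R := y * (e * s y)^-1.
have ds (y : R) : y \in `[0, C * h] -> is_derive y 1 s ((- (2 * y)) / (2 * s y)).
  move=> yB; apply: is_derive_sqrt_comp; first exact: iY.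
  rewrite (_ : (fun z => _) = cst e - (@id R) ^+ 2)//.
  apply: is_derive_eq; rewrite sub0r /GRing.scale/= expr1 mulr1//.
rewrite -[RHS](_ : (F (C * h) - F 0)%:E = _); last first.
  rewrite /F mul0r subr0 /s YE sqrtr_sqr gtr0_norm//; congr (_%:E).
  by field; rewrite !gt_eqF.
apply: is_derive_FTC2; first by rewrite mulr_ge0// ltW.
- move=> y yB; have sy : 0 < s y by rewrite sqrtr_gt0 iY.
  pose g (z : R) : R := e * s z.
  have esy : g y != 0 by rewrite gt_eqF// mulr_gt0.
  have did : is_derive y 1 (@id R) 1 by exact: is_derive_id.
  have dd : is_derive y 1 g (e * ((- (2 * y)) / (2 * s y))).
    exact: (is_deriveZ e (ds y yB)).
  apply: (@is_derive_eq _ _ _ _ _ _ _ _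
    (is_deriveM did (is_deriveV esy dd))).
  rewrite /g /GRing.scale/= -/(s y).
  have -> : e = s y ^+ 2 + y ^+ 2 by rewrite sqr_sqrtr ?subrK// ltW// iY.
  field; rewrite !gt_eqF//=; nra.
- move=> y yB; have sy : 0 < s y by rewrite sqrtr_gt0 iY.
  apply: cvgV; first by rewrite gt_eqF// exprn_gt0.
  apply: (@continuous_comp _ _ _ s (fun z => z ^+ 3)); last exact: exprn_continuous.
  apply: (@continuous_comp _ _ _ (fun z : R => e - z ^+ 2) Num.sqrt);
    last exact: sqrt_continuous.
  by apply: cvgB; [exact: cvg_cst|exact: exprn_continuous].
Qed.

(** For 0 <= x < 1 the last condition already forces (x, y) into the disc, and
it bounds y by C sqrt ((1 - x ^ 2) / (1 + C ^ 2)). *)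
Lemma Vol_equidistant_strip (a C : R) (S : set plane) : a < 1 -> 0 <= C ->
  (forall x y, S (x, y) <->
    [/\ 0 <= x <= a, 0 <= y & y ^+ 2 <= C ^+ 2 * (1 - x ^+ 2 - y ^+ 2)]) ->
  measurable S ->
  Vol S = (\int[mu]_(x in `[0%R, a]) (C / (1 - x ^+ 2))%:E)%E.
Proof.
move=> a1 C0 SE mS; rewrite Vol_iterated// [RHS]integral_mkcond.
apply: eq_integral => x _; rewrite patchE.
case: ifPn => [/set_mem/=|/negP xB]; last first.
  apply: integral0_eq => y _; rewrite /density_on patchE memNset//= => /SE[xa _ _].
  by apply: xB; rewrite inE/= in_itv.
rewrite in_itv/= => xa.
have e0 : 0 < 1 - x ^+ 2 by nra.
have c0 : 0 < 1 + C ^+ 2 by rewrite ltr_pwDl// sqr_ge0.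
rewrite -(integral_equidistant_slice _ _ e0 C0) [RHS]integral_mkcond.
apply: eq_integral => y _; rewrite /density_on !patchE.
have -> : (y \in `[0, (C * Num.sqrt ((1 - x ^+ 2) / (1 + C ^+ 2)))]%classic) =
    (((x, y) : plane) \in S).
  set h := Num.sqrt _.
  have hE : h ^+ 2 = (1 - x ^+ 2) / (1 + C ^+ 2).
    by rewrite sqr_sqrtr// divr_ge0 ?ltW.
  have YE : 0 <= y ->
      (y <= C * h) = (y ^+ 2 <= C ^+ 2 * (1 - x ^+ 2 - y ^+ 2)).
    move=> y0; rewrite -(@ler_pXn2r R 2)// ?nnegrE ?mulr_ge0 ?sqrtr_ge0//.
    rewrite exprMn hE mulrA ler_pdivlMr//.
    by apply/idP/idP; lra.
  apply/idP/idP; rewrite !inE/= in_itv/=.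
    by move=> /andP[y0]; rewrite YE// => yY; apply/SE.
  by move=> /SE[_ y0]; rewrite -YE// y0.
case: ifPn => // _; congr (_%:E); rewrite /klein_density /Defs.form/=.
by congr ((Num.sqrt _ ^+ 3)^-1); ring.
Qed.

Lemma measurable_hypercycle_piece (a t : R) : 0 < a -> disc (M a t) ->
  measurable (hypercycle_piece a t : set plane).
Proof.
move=> a0 dM; do 3 ?[apply: measurableI; last exact: measurable_left_side].
rewrite (_ : [set p | _ /\ _] = @disc R `&` [set p : plane |
    p.2 ^+ 2 <= (M a t).2 ^+ 2 / - Defs.form (M a t) (M a t) * - Defs.form p p]).
  apply: measurableI; first exact: measurable_disc.
  apply: measurable_le_set; first by apply: measurable_funX; exact: measurable_snd.
  by apply: measurable_funM => //; exact: (measurable_funN measurable_form_diag).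
by apply/seteqP; split => p [dp]/=; rewrite le_hdist_line_axis// ler_pdivrMr ?oppr_gt0.
Qed.

(** The quotient in front is sinh h, so this is the formula d(A1, P1) sinh h. *)
Lemma Vol_hypercycle_piece (a t : R) : 0 < a < 1 -> 0 < t <= 1 ->
  Vol (hypercycle_piece a t) =
  ((1 - t * a ^+ 2) / Num.sqrt (t * a ^+ 2 * (2 - t - t * a ^+ 2))
    * half_log_ratio a)%:E.
Proof.
move=> a01 t01; have a0 : 0 < a by case/andP: a01.
have t0 : 0 < t by case/andP: t01.
have a2 : 0 < a ^+ 2 < 1 by nra.
have D0 : 0 < t * a ^+ 2 * (2 - t - t * a ^+ 2).
  by rewrite !mulr_gt0//; nra.
have dM : disc (M a t) by rewrite /disc/= -oppr_gt0 form_M.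
set C := _ / Num.sqrt _.
have C0 : 0 <= C by rewrite divr_ge0 ?sqrtr_ge0//; nra.
have C2 : C ^+ 2 = (M a t).2 ^+ 2 / - Defs.form (M a t) (M a t).
  by rewrite /C expr_div_n sqr_sqrtr ?(ltW D0)// form_M.
rewrite (Vol_equidistant_strip a C)//; last 3 first.
- by case/andP: a01.
- move=> x y; have fE : - Defs.form (x, y) (x, y) = 1 - x ^+ 2 - y ^+ 2.
    by rewrite /Defs.form/=; ring.
  have stripE : disc (x, y) ->
      (hdist_line (x, y) (hline (A1 R) (P1 a)) <=
       hdist_line (M a t) (hline (A1 R) (P1 a))) =
      (y ^+ 2 <= C ^+ 2 * (1 - x ^+ 2 - y ^+ 2)).
    move=> dp; rewrite le_hdist_line_axis// -C2 ler_pdivrMr ?oppr_gt0//.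
    by rewrite fE.
  rewrite /hypercycle_piece; split.
  + move=> [[[[dp h] l1] l2] l3].
    split; last by rewrite -stripE.
    - by rewrite ((left_side_A0A1 dp).1 l2) ((left_side_P1P0 a01 dp).1 l3).
    - exact/(left_side_A1P1 a0 dp).
  + move=> [/andP[x0 xa] y0 h].
    have dp : disc (x, y).
      rewrite /disc/= -oppr_gt0 fE ltNge; apply/negP => n.
      have : C ^+ 2 * (1 - x ^+ 2 - y ^+ 2) <= 0 by rewrite mulr_ge0_le0 ?sqr_ge0.
      by nra.
    split; last exact/(left_side_P1P0 a01 dp).
    split; last exact/(left_side_A0A1 dp).
    split; last exact/(left_side_A1P1 a0 dp).
    by split => //=; rewrite stripE.
- exact: measurable_hypercycle_piece.
under eq_integral do rewrite EFinM.
rewrite ge0_integralZl//=; last 2 first.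
- by apply/measurable_EFinP; apply: measurable_inv_1Bsqr; lra.
- move=> x; rewrite in_itv/= => xa; rewrite lee_fin invr_ge0; nra.
by rewrite integral_half_log_ratio ?EFinM//; lra.
Qed.

End hypercycle.

(** * The density at t = 1/2 *)

Section density_at_half.
Context {R : realType}.

(** The density as a function of z = a ^ 2 and r = d(A1, P1) / a, made
independent variables so that the limit value is itself a value. *)
Definition density_profile (z r : R) : R :=
  ((2 - z) * r + 1) / Num.sqrt (3 - z) * (2 / pi).

Lemma density_half (a : R) : 0 < a < 1 ->
  density a 2^-1 = density_profile (a ^+ 2) (half_log_ratio a / a).
Proof.
move=> a01; have a0 : 0 < a by case/andP: a01.
have t01 : 0 < (2^-1 : R) <= 1 by lra.
have z1 : 0 < 3 - a ^+ 2 by nra.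
have s0 : Num.sqrt (3 - a ^+ 2) != 0 by rewrite gt_eqF// sqrtr_gt0.
rewrite /density Vol_hypercycle_piece// Vol_horocycle_piece// Vol_Lambert_quad//=.
have -> : 2^-1 / (2 - 2^-1 - 2^-1 * a ^+ 2) = (3 - a ^+ 2)^-1.
  by field; rewrite gt_eqF.
have -> : 2^-1 * a ^+ 2 * (2 - 2^-1 - 2^-1 * a ^+ 2) = (a / 2) ^+ 2 * (3 - a ^+ 2).
  by field.
rewrite sqrtrM ?sqr_ge0// sqrtr_sqr gtr0_norm ?divr_gt0// sqrtrV ?(ltW z1)//.
rewrite /density_profile; move: (@pi R) (pi_gt0 R) => p p0; field.
by rewrite s0 !gt_eqF.
Qed.

Lemma sqrt12E : Num.sqrt 12 / pi = density_profile 0 1.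
Proof.
rewrite /density_profile !subr0 mulr1 (_ : 2 + 1 = 3); last by ring.
have -> : (12 : R) = 2 ^+ 2 * 3 by ring.
rewrite sqrtrM ?sqr_ge0// sqrtr_sqr gtr0_norm//.
have s3 : 0 < Num.sqrt (3 : R) by rewrite sqrtr_gt0.
have -> : (3 : R) / Num.sqrt 3 = Num.sqrt 3.
  by rewrite -{1}(@sqr_sqrtr R 3)// expr2 mulfK// gt_eqF.
by ring.
Qed.

(** Inserting the lower bound of r, the margin over 3 - z / 2 is
z (1/6 + z/15 - z^2/5), positive for 0 < z < 1; and 3 - z / 2 is at least
sqrt (9 - 3 z). *)
Lemma sqrt12_lt_density (a : R) : 0 < a < 1 ->
  Num.sqrt 12 / pi < density a 2^-1.
Proof.
move=> a01; have a0 : 0 < a by case/andP: a01.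
rewrite density_half// /density_profile mulrA ltr_pM2r ?invr_gt0 ?pi_gt0//.
pose z := a ^+ 2; rewrite -/z; have z01 : 0 < z < 1 by rewrite /z; nra.
pose r := half_log_ratio a / a; rewrite -/r.
have rz : 1 + z / 3 + z ^+ 2 / 5 <= r.
  rewrite /r ler_pdivlMr//; apply: le_trans (half_log_ratio_ge _ a01).
  by rewrite /z; lra.
have X : 3 - z / 2 < (2 - z) * r + 1.
  have : (2 - z) * (1 + z / 3 + z ^+ 2 / 5) <= (2 - z) * r by rewrite ler_pM2l//; lra.
  have : 0 < z * (1 / 6 + z / 15 - z ^+ 2 / 5) by rewrite mulr_gt0//; nra.
  by lra.
have s3 : 0 < Num.sqrt (3 - z) by rewrite sqrtr_gt0; lra.
rewrite mulrAC ltr_pdivlMr// -sqrtrM//.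
apply: (@lt_trans _ _ ((3 - z / 2) * 2)); last by rewrite ltr_pM2r.
rewrite -[ltRHS]gtr0_norm; last by lra.
rewrite -sqrtr_sqr ltr_sqrt; nra.
Qed.

Lemma density_half_le (a : R) : 0 < a < 1 ->
  density a 2^-1 <= density_profile (a ^+ 2) (1 - a ^+ 2)^-1.
Proof.
move=> a01; have a0 : 0 < a by case/andP: a01.
have z01 : 0 < a ^+ 2 < 1 by nra.
rewrite density_half// /density_profile.
rewrite ler_pM2r ?divr_gt0 ?pi_gt0// ler_pM2r ?invr_gt0 ?sqrtr_gt0; last lra.
rewrite lerD2r ler_pM2l; last lra.
by rewrite ler_pdivrMr// mulrC half_log_ratio_le.
Qed.

(** Squeeze: the limit value bounds the density from below. *)
Lemma density_half_cvg :
  density a (2^-1 : R) @[a --> (0 : R)^'+] --> Num.sqrt 12 / pi.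
Proof.
pose U (a : R) : R := density_profile (a ^+ 2) (1 - a ^+ 2)^-1.
have cU : U a @[a --> (0 : R)^'+] --> Num.sqrt 12 / pi.
  have -> : Num.sqrt 12 / pi = U 0 by rewrite /U sqrt12E expr0n/= subr0 invr1.
  apply: cvg_at_right_filter.
  have csub (c : R) : {for 0, continuous (fun a : R => c - a ^+ 2)}.
    by apply: cvgB; [exact: cvg_cst|exact: exprn_continuous].
  have c0 (c : R) : 0 < c -> 0 < c - 0 ^+ 2 by rewrite expr0n/= subr0.
  apply: cvgM; last exact: cvg_cst.
  apply: cvgM; last first.
    apply: (continuous_inv_sqrt (fun a : R => 3 - a ^+ 2) 0 _ (csub 3)).
    exact: c0.
  apply: cvgD; last exact: cvg_cst.
  apply: cvgM; first exact: csub.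
  by apply: cvgV; [rewrite gt_eqF// c0|exact: csub].
apply: squeeze_cvgr (cvg_cst _) cU.
near=> a.
have a01 : 0 < a < 1.
  by apply/andP; split; near: a; [exact: nbhs_right_gt|exact: nbhs_right_lt].
by rewrite (ltW (sqrt12_lt_density _ a01)) density_half_le.
Unshelve. all: by end_near. Qed.

End density_at_half.

Theorem theorem3p2 (R : realType) :
  [/\ density a (2^-1 : R) @[a --> (0 : R)^'+] --> Num.sqrt 12 / pi,
      forall a : R, 0 < a < 1 -> Num.sqrt 12 / pi < density a 2^-1
    & forall eps : R, 0 < eps ->
        exists a : R, 0 < a < 1 /\
          `|density a 2^-1 - Num.sqrt 12 / pi| < eps].
Proof.
split; first exact: density_half_cvg.
  exact: sqrt12_lt_density.
move=> eps eps0.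
suff /(@filter_ex _ ((0:R)^'+)) [a [a01 ha]] : \forall a \near (0 : R)^'+,
    0 < a < 1 /\ `|density a 2^-1 - Num.sqrt 12 / pi| < eps by exists a.
near=> a; split.
  by apply/andP; split; near: a; [exact: nbhs_right_gt|exact: nbhs_right_lt].
rewrite distrC; near: a.
by move/cvgrPdist_lt : (@density_half_cvg R); apply.
Unshelve. all: by end_near. Qed.
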